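(* Work in ZF (the Axiom of Choice is not assumed). Let $\mathfrak L$ be a class of cardinals such that the ordinals $\aleph^*(\mathfrak l)$, $\mathfrak l\in\mathfrak L$, are bounded, and let $\mathfrak m,\mathfrak n$ be cardinals. If $\mathrm{Cov}(\mathfrak L,\mathfrak m,\mathfrak n)$ holds, then $$\aleph(\mathfrak n)\le\aleph^*\Big(\sup_{\mathfrak l\in\mathfrak L}\aleph(\mathfrak l)\cdot\mathfrak m\Big)\quad\text{and}\quad \aleph^*(\mathfrak n)\le\aleph^*\Big(\sup_{\mathfrak l\in\mathfrak L}\aleph^*(\mathfrak l)\cdot\mathfrak m\Big).$$
   Context: For a set $X$, $|X|$ denotes its cardinal; well-ordered cardinals are identified with initial ordinals, and an ordinal $\delta$ used as a cardinal means $|\delta|$. $|X|\le|Y|$ means $X$ is empty or there is an injection of $X$ into $Y$; $|X|\le^{*}|Y|$ means $X$ is empty or there is a surjection of $Y$ onto $X$. $|X|\cdot|Y|=|X\times Y|$. Hartogs: $\aleph(\mathfrak n)=\{\alpha\in\mathrm{Ord}:|\alpha|\le\mathfrak n\}$; Lindenbaum: $\aleph^*(\mathfrak n)=\{\alpha\in\mathrm{Ord}:|\alpha|\le^*\mathfrak n\}$; both are ordinals and $\aleph(\mathfrak n)\le\aleph^*(\mathfrak n)$. The suprema are suprema of ordinals. $\mathrm{Cov}(\mathfrak L,\mathfrak m,\mathfrak n)$ means: there are a set $X$ with $|X|=\mathfrak n$ and a family $\langle A_i:i\in I\rangle$ with $|I|=\mathfrak m$, each $|A_i|\in\mathfrak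 L$, and $X\subseteq\bigcup_{i\in I}A_i$. *)

(* Defs.v *)
From Stdlib Require Import ClassicalEpsilon.

(** "Provable in ZF" is rendered as "true in every model of ZF", with the
    separation and replacement schemes restricted to first-order formulas.
    Schemes ranging over all Rocq predicates would, by choice in the
    metatheory, make every model satisfy the axiom of choice. *)

(** First-order formulas of the language {∈, =}, with de Bruijn variables. *)
Inductive form : Type :=
| fMem (i j : nat)
| fEq (i j : nat)
| fBot
| fImp (p q : form)
| fAnd (p q : form)
| fOr (p q : form)
| fAll (p : form)
| fEx (p : form).

Record structure : Type := Structure {
  dom :> Type;
  mem : dom -> dom -> Prop;
  dom_inhabited : inhabited dom
}.

Arguments mem {s} _ _.
Notation "x ∈ y" := (mem x y) (at level 70, no associativity).

Definition scons {T : Type} (x : T) (e : nat -> T) (k : nat) : T :=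
  match k with O => x | S k' => e k' end.

Fixpoint sat (M : structure) (e : nat -> M) (p : form) : Prop :=
  match p with
  | fMem i j => e i ∈ e j
  | fEq i j => e i = e j
  | fBot => False
  | fImp p q => sat M e p -> sat M e q
  | fAnd p q => sat M e p /\ sat M e q
  | fOr p q => sat M e p \/ sat M e q
  | fAll p => forall x : M, sat M (scons x e) p
  | fEx p => exists x : M, sat M (scons x e) p
  end.

Definition subset {M : structure} (a b : M) : Prop :=
  forall x : M, x ∈ a -> x ∈ b.

Definition is_empty {M : structure} (a : M) : Prop :=
  forall x : M, ~ x ∈ a.

(** [s] is the successor [x ∪ {x}]. *)
Definition is_succ {M : structure} (s x : M) : Prop :=
  forall y : M, y ∈ s <-> (y ∈ x \/ y = x).

Record ZF (M : structure) : Prop := {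
  zf_extensionality : forall a b : M,
    (forall x, x ∈ a <-> x ∈ b) -> a = b;
  zf_foundation : forall a : M,
    (exists x, x ∈ a) -> exists x, x ∈ a /\ forall y, y ∈ x -> ~ y ∈ a;
  zf_pairing : forall a b : M,
    exists c, forall x, x ∈ c <-> (x = a \/ x = b);
  zf_union : forall a : M,
    exists b, forall x, x ∈ b <-> exists y, x ∈ y /\ y ∈ a;
  zf_powerset : forall a : M,
    exists b, forall x, x ∈ b <-> subset x a;
  zf_infinity : exists a : M,
    (exists z, is_empty z /\ z ∈ a) /\
    (forall x, x ∈ a -> exists s, is_succ s x /\ s ∈ a);
  zf_separation : forall (p : form) (e : nat -> M) (a : M),
    exists b, forall x, x ∈ b <-> (x ∈ a /\ sat M (scons x e) p);
  zf_replacement : forall (p : form) (e : nat -> M) (a : M),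
    (forall x y y', x ∈ a -> sat M (scons x (scons y e)) p ->
       sat M (scons x (scons y' e)) p -> y = y') ->
    exists b, forall y,
      y ∈ b <-> exists x, x ∈ a /\ sat M (scons x (scons y e)) p
}.

(** The proper classes of a model of ZF are the collections definable by a
    first-order formula with parameters, here given by [e]. *)
Definition definable {M : structure} (P : M -> Prop) : Prop :=
  exists (p : form) (e : nat -> M), forall x, P x <-> sat M (scons x e) p.

(** Meant for [P] with exactly one witness. *)
Definition the {M : structure} (P : M -> Prop) : M :=
  epsilon (dom_inhabited M) P.

Definition is_upair {M : structure} (c x y : M) : Prop :=
  forall z : M, z ∈ c <-> (z = x \/ z = y).

(** Kuratowski pair [{{x}, {x, y}}]. *)
Definition is_opair {M : structure} (c x y : M) : Prop :=
  exists s t : M, is_upair s x x /\ is_upair t x y /\ is_upair c s t.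

Definition is_prod {M : structure} (p a b : M) : Prop :=
  forall z : M, z ∈ p <-> exists x y, x ∈ a /\ y ∈ b /\ is_opair z x y.

(** The ordered pair [(x, y)] belongs to [f]. *)
Definition maps {M : structure} (f x y : M) : Prop :=
  exists c : M, is_opair c x y /\ c ∈ f.

Definition is_fun_on {M : structure} (f a : M) : Prop :=
  (forall c, c ∈ f -> exists x y, x ∈ a /\ is_opair c x y) /\
  (forall x, x ∈ a -> exists! y, maps f x y).

Definition is_fun {M : structure} (f a b : M) : Prop :=
  is_fun_on f a /\ (forall x y, maps f x y -> y ∈ b).

Definition is_inj {M : structure} (f a b : M) : Prop :=
  is_fun f a b /\ (forall x x' y, maps f x y -> maps f x' y -> x = x').

Definition is_surj {M : structure} (f a b : M) : Prop :=
  is_fun f a b /\ (forall y, y ∈ b -> exists x, maps f x y).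

Definition equipotent {M : structure} (a b : M) : Prop :=
  exists f : M, is_inj f a b /\ is_surj f a b.

(** Cardinals are equipotence classes, [card x] being the cardinal of [x], so
    that [card x = card y] exactly when [x] and [y] are equipotent (by functional and
    propositional extensionality). *)
Definition card {M : structure} (x : M) : M -> Prop :=
  fun z => equipotent x z.

Definition is_cardinal {M : structure} (c : M -> Prop) : Prop :=
  exists x : M, c = card x.

(** A class of cardinals [L] is coded by the class [{x : |x| ∈ L}], which has
    to be a class of the model. *)
Definition cardinal_class {M : structure} (L : (M -> Prop) -> Prop) : Prop :=
  (forall c, L c -> is_cardinal c) /\ definable (fun x => L (card x)).

Definition card_le {M : structure} (c d : M -> Prop) : Prop :=
  exists x y : M, c = card x /\ d = card y /\
    (is_empty x \/ exists f, is_inj f x y).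

Definition card_le_star {M : structure} (c d : M -> Prop) : Prop :=
  exists x y : M, c = card x /\ d = card y /\
    (is_empty x \/ exists f, is_surj f y x).

Definition card_mul {M : structure} (c d : M -> Prop) : M -> Prop :=
  fun z => exists x y p : M,
    c = card x /\ d = card y /\ is_prod p x y /\ card p z.

(** Von Neumann ordinals: transitive sets well ordered by membership. *)
Definition is_ord {M : structure} (a : M) : Prop :=
  (forall x, x ∈ a -> subset x a) /\
  (forall x, x ∈ a -> ~ x ∈ x) /\
  (forall x y z, x ∈ a -> y ∈ a -> z ∈ a -> x ∈ y -> y ∈ z -> x ∈ z) /\
  (forall x y, x ∈ a -> y ∈ a -> x ∈ y \/ x = y \/ y ∈ x) /\
  (forall b, subset b a -> (exists x, x ∈ b) ->
     exists x, x ∈ b /\ forall y, y ∈ b -> x = y \/ x ∈ y).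

Definition ord_le {M : structure} (a b : M) : Prop := a ∈ b \/ a = b.

Definition is_sup {M : structure} (S : M -> Prop) (s : M) : Prop :=
  is_ord s /\ (forall a, S a -> ord_le a s) /\
  (forall t, is_ord t -> (forall a, S a -> ord_le a t) -> ord_le s t).

(** Hartogs number. *)
Definition aleph {M : structure} (c : M -> Prop) : M :=
  the (fun h => forall a : M, a ∈ h <-> (is_ord a /\ card_le (card a) c)).

(** Lindenbaum number. *)
Definition aleph_star {M : structure} (c : M -> Prop) : M :=
  the (fun h => forall a : M, a ∈ h <-> (is_ord a /\ card_le_star (card a) c)).

(** The supremum of the ordinals [F l] for [l] in [L]. *)
Definition ord_sup {M : structure} (L : (M -> Prop) -> Prop)
    (F : (M -> Prop) -> M) : M :=
  the (is_sup (fun a => exists l, L l /\ a = F l)).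

Definition ord_bounded {M : structure} (L : (M -> Prop) -> Prop)
    (F : (M -> Prop) -> M) : Prop :=
  exists b : M, is_ord b /\ forall l, L l -> ord_le (F l) b.

(** The family [A_i], [i ∈ I], is the function [A] with domain [I]. *)
Definition Cov {M : structure} (L : (M -> Prop) -> Prop) (m n : M -> Prop)
    : Prop :=
  exists X I A : M,
    card X = n /\ card I = m /\ is_fun_on A I /\
    (forall i Ai, maps A i Ai -> L (card Ai)) /\
    (forall x, x ∈ X -> exists i Ai, maps A i Ai /\ x ∈ Ai).

(* Main.v *)
(** Let [X] be covered by the sets [A_i], [i ∈ I], and let the ordinal [a] inject into
    [X] (resp. be an image of [X]). Each [A_i] cuts out a set [B_i] of elements of [a];
    for [v ∈ B_i] the order type of [B_i ∩ v] injects into (resp. is an image of) [A_i],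
    hence lies below the supremum [s]. As [B_i] has a canonical enumeration by order
    types, no choice is needed to map [(b, i)] to the [b]-th element of [B_i], and this
    is a partial function from [s × I] onto [a].

    Induction, separation and replacement are available in the model only for
    first-order definable predicates. *)

From Stdlib Require Import Classical FunctionalExtensionality PropExtensionality.
From Stdlib Require Import ClassicalEpsilon PeanoNat.
Require Import Defs.

(** * Definability with parameters *)

(** The map [r] need not be injective: [dfn_body] and [replacement] use it to identify variables. *)
Fixpoint rename (r : nat -> nat) (p : form) : form :=
  let up := fun k => match k with O => O | S k' => S (r k') end in
  match p with
  | fMem i j => fMem (r i) (r j)
  | fEq i j => fEq (r i) (r j)
  | fBot => fBot
  | fImp p q => fImp (rename r p) (rename r q)
  | fAnd p q => fAnd (rename r p) (rename r q)
  | fOr p q => fOr (rename r p) (rename r q)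
  | fAll p => fAll (rename up p)
  | fEx p => fEx (rename up p)
  end.

Section Definability.
Context {M : structure}.

(** Environments are compared pointwise, so the identity renaming also shows that satisfaction
    depends only on the values of an environment. *)
Lemma sat_rename (p : form) : forall (r : nat -> nat) (e e' : nat -> M),
  (forall k, e' k = e (r k)) -> (sat M e (rename r p) <-> sat M e' p).
Proof.
  assert (Hup : forall (r : nat -> nat) (e e' : nat -> M) x,
    (forall k, e' k = e (r k)) -> forall k, scons x e' k =
      scons x e (match k with O => O | S k' => S (r k') end)).
  { intros r e e' x H [|k]; simpl; auto. }
  induction p; simpl; intros r e e' H;
    try (rewrite !H; tauto); try tauto;
    try (rewrite (IHp1 r e e' H), (IHp2 r e e' H); tauto).
  - split; intros Hx x; apply (IHp _ _ _ (Hup r e e' x H)), Hx.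
  - split; intros [x Hx]; exists x; apply (IHp _ _ _ (Hup r e e' x H)), Hx.
Qed.

(** A term is a variable [inl k] or a parameter [inr c]. *)
Definition tm (e : nat -> M) (t : nat + M) : M :=
  match t with inl k => e k | inr c => c end.

(** [P] is given by a formula whose free variables are read as terms. *)
Definition dfn (P : (nat -> M) -> Prop) : Prop :=
  exists (p : form) (r : nat -> nat + M),
    forall e, P e <-> sat M (fun i => tm e (r i)) p.

Definition is_term (t : (nat -> M) -> M) : Prop :=
  exists v, forall e, t e = tm e v.

Lemma is_term_var k : is_term (fun e => e k).
Proof. exists (inl k); reflexivity. Qed.

Lemma is_term_param c : is_term (fun _ => c).
Proof. exists (inr c); reflexivity. Qed.

Lemma dfn_mem t u : is_term t -> is_term u -> dfn (fun e => t e ∈ u e).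
Proof.
  intros [v Hv] [w Hw]. exists (fMem 0 1), (fun i => match i with O => v | _ => w end).
  intro e; simpl; rewrite Hv, Hw; tauto.
Qed.

Lemma dfn_eq t u : is_term t -> is_term u -> dfn (fun e => t e = u e).
Proof.
  intros [v Hv] [w Hw]. exists (fEq 0 1), (fun i => match i with O => v | _ => w end).
  intro e; simpl; rewrite Hv, Hw; tauto.
Qed.

Lemma dfn_False : dfn (fun _ => False).
Proof. exists fBot, inl; simpl; tauto. Qed.

(* Even variables are used for the left formula, odd ones for the right one. *)
Lemma dfn_binary (c : form -> form -> form) (C : Prop -> Prop -> Prop) P Q :
  (forall e p q, sat M e (c p q) <-> C (sat M e p) (sat M e q)) ->
  dfn P -> dfn Q -> dfn (fun e => C (P e) (Q e)).
Proof.
  intros Hc [p [r Hp]] [q [s Hq]].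
  exists (c (rename (fun i => 2 * i) p) (rename (fun i => S (2 * i)) q)),
    (fun k => if Nat.even k then r (Nat.div2 k) else s (Nat.div2 k)).
  intro e. rewrite Hc.
  (* As [C] is an arbitrary operation on propositions, equivalent propositions are exchanged inside
     it as equal ones. *)
  replace (P e) with (sat M (fun i => tm e (r i)) p)
    by (apply propositional_extensionality; symmetry; auto).
  replace (Q e) with (sat M (fun i => tm e (s i)) q)
    by (apply propositional_extensionality; symmetry; auto).
  rewrite <- (propositional_extensionality _ _ (sat_rename p (fun i => 2 * i)
    (fun k => tm e (if Nat.even k then r (Nat.div2 k) else s (Nat.div2 k)))
    (fun i => tm e (r i))
    ltac:(intro k; cbv beta; rewrite Nat.even_even, Nat.div2_double; reflexivity))).
  rewrite <- (propositional_extensionality _ _ (sat_rename q (fun i => S (2 * i))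
    (fun k => tm e (if Nat.even k then r (Nat.div2 k) else s (Nat.div2 k)))
    (fun i => tm e (s i))
    ltac:(intro k; cbv beta; replace (Nat.even (S (2 * k))) with false
      by (symmetry; rewrite Nat.even_succ; apply Nat.odd_even);
      rewrite Nat.div2_succ_double; reflexivity))).
  tauto.
Qed.

Lemma dfn_and P Q : dfn P -> dfn Q -> dfn (fun e => P e /\ Q e).
Proof. apply (dfn_binary fAnd and); simpl; tauto. Qed.

Lemma dfn_or P Q : dfn P -> dfn Q -> dfn (fun e => P e \/ Q e).
Proof. apply (dfn_binary fOr or); simpl; tauto. Qed.

Lemma dfn_imp P Q : dfn P -> dfn Q -> dfn (fun e => P e -> Q e).
Proof. apply (dfn_binary fImp (fun A B => A -> B)); simpl; tauto. Qed.

(* All occurrences of the quantified variable [inl 0] are collected in variable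
   [0] of the formula. *)
Lemma dfn_body (P : (nat -> M) -> M -> Prop) :
  dfn (fun e => P (fun k => e (S k)) (e 0)) ->
  exists p (r : nat -> nat + M),
    forall e x, P e x <-> sat M (scons x (fun i => tm e (r i))) p.
Proof.
  intros [p [r Hp]].
  (* The other terms move up to [S i]. Where [r i] is [inl 0], the second map keeps [inl 0] as a
     default value that the renamed formula never reads. *)
  exists (rename (fun i => match r i with inl O => O | _ => S i end) p),
    (fun i => match r i with inl (S j) => inl j | t => t end).
  intros e x. rewrite sat_rename; [apply (Hp (scons x e))|].
  intro k; simpl. destruct (r k) as [[|j]|c] eqn:E; simpl; try rewrite E; reflexivity.
Qed.

Lemma dfn_ex (P : (nat -> M) -> M -> Prop) :
  dfn (fun e => P (fun k => e (S k)) (e 0)) -> dfn (fun e => exists x, P e x).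
Proof.
  intros H; destruct (dfn_body P H) as [p [r Hp]]; exists (fEx p), r; intro e; simpl.
  split; intros [x Hx]; exists x; apply Hp, Hx.
Qed.

Lemma dfn_all (P : (nat -> M) -> M -> Prop) :
  dfn (fun e => P (fun k => e (S k)) (e 0)) -> dfn (fun e => forall x, P e x).
Proof.
  intros H; destruct (dfn_body P H) as [p [r Hp]]; exists (fAll p), r; intro e; simpl.
  split; intros Hx x; apply Hp, Hx.
Qed.

Definition dfn1 (P : M -> Prop) : Prop := dfn (fun e => P (e 0)).
Definition dfn2 (R : M -> M -> Prop) : Prop := dfn (fun e => R (e 0) (e 1)).

(** This links the calculus of [dfn] with the classes of the model: it turns the hypothesis on the
    class of cardinals into [dfn1], and [dfn1] into instances of separation. *)
Lemma dfn1_definable (P : M -> Prop) : definable P <-> dfn1 P.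
Proof.
  split.
  - intros [p [c Hp]]; exists p, (fun i => match i with O => inl 0 | S j => inr (c j) end).
    intro e; rewrite Hp, <- (sat_rename p (fun k => k)); [|reflexivity].
    apply sat_rename; intros [|k]; reflexivity.
  - intro H; destruct (dfn_body (fun _ => P) H) as [p [r Hp]].
    (* The predicate has no variable besides its argument, so those left over may take any value
       [c]. *)
    destruct (dom_inhabited M) as [c].
    exists p, (fun i => tm (fun _ => c) (r i)); intro x; apply Hp.
Qed.

(** The truth of [P] depends on variable 0 alone, so all variables of its formula may be read as the
    one term [v]. *)
Lemma dfn1_app P t : dfn1 P -> is_term t -> dfn (fun e => P (t e)).
Proof.
  intros [p [r Hp]] [v Hv].
  exists p, (fun i => match r i with inl _ => v | inr c => inr c end).
  intro e. rewrite Hv, (Hp (fun _ => tm e v)), <- (sat_rename p (fun k => k)); [|reflexivity].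
  apply sat_rename; intro k; destruct (r k); reflexivity.
Qed.

Lemma dfn2_app R t u :
  dfn2 R -> is_term t -> is_term u -> dfn (fun e => R (t e) (u e)).
Proof.
  intros [p [r Hp]] [v Hv] [w Hw].
  exists p, (fun i => match r i with inl O => v | inl _ => w | inr c => inr c end).
  intro e. rewrite Hv, Hw.
  rewrite (Hp (fun k => match k with O => tm e v | _ => tm e w end)),
    <- (sat_rename p (fun k => k)); [|reflexivity].
  apply sat_rename; intro k; destruct (r k) as [[|j]|c]; reflexivity.
Qed.

End Definability.

(** * Automatic proofs of definability *)

Ltac is_term_tac := first [ apply is_term_var | apply is_term_param ].

(** The goal is taken apart along its connectives, opaque predicates are handled by hypotheses
    [dfn1] and [dfn2], and the listed notions are unfolded only when no other rule fits. The notions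
    [psurj] and [collapse] are not listed and are unfolded before a call. *)
Ltac dfn_tac :=
  unfold dfn1, dfn2;
  repeat (cbv beta;
  lazymatch goal with
  | |- dfn (fun e => @mem _ (@?t e) (@?u e)) => apply (dfn_mem t u); is_term_tac
  | |- dfn (fun e => @?t e = @?u e) => apply (dfn_eq t u); is_term_tac
  | |- dfn (fun e => (@?P e) /\ (@?Q e)) => apply (dfn_and P Q)
  | |- dfn (fun e => (@?P e) \/ (@?Q e)) => apply (dfn_or P Q)
  | |- dfn (fun _ => False) => apply dfn_False
  | |- dfn (fun e => exists x, @?P e x) => apply (dfn_ex P)
  | |- dfn (fun e => forall x : dom _, @?P e x) => apply (dfn_all P)
  | |- dfn (fun e => (@?P e) -> (@?Q e)) => apply (dfn_imp P Q)
  | H : dfn1 ?P |- dfn (fun e => ?P (@?t e)) => apply (dfn1_app P t H); is_term_tac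
  | H : dfn2 ?R |- dfn (fun e => ?R (@?t e) (@?u e)) =>
      apply (dfn2_app R t u H); is_term_tac
  | |- dfn _ => progress unfold is_fun_on, is_inj, is_surj, is_fun, is_ord, maps,
      is_opair, is_upair, unique, subset, ord_le, is_empty, not, iff
  end).

(** * Sets, relations and cardinals in a model of ZF *)

(* Partial functions make the case of empty [a], singled out in [card_le_star],
   uniform. *)
Definition psurj {M : structure} (x a : M) : Prop :=
  exists g : M,
    (forall u v v', u ∈ x -> maps g u v -> maps g u v' -> v = v') /\
    (forall v, v ∈ a -> exists u, u ∈ x /\ maps g u v).

(* [b] is the transitive collapse of [{z ∈ B : z ∈ x}]; the set [h] is a
   bisimulation, so no compatibility between different [h] has to be proved. *)
Definition collapse {M : structure} (B b x : M) : Prop :=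
  exists h : M, maps h b x /\
    forall c y, maps h c y ->
      y ∈ B /\
      (forall d, d ∈ c -> exists z, z ∈ B /\ z ∈ y /\ maps h d z) /\
      (forall z, z ∈ B -> z ∈ y -> exists d, d ∈ c /\ maps h d z).

Section Sets.
Context {M : structure} (HZF : ZF M).

Lemma separation (P : M -> Prop) a :
  dfn1 P -> exists b, forall x, x ∈ b <-> (x ∈ a /\ P x).
Proof.
  intro H; apply dfn1_definable in H; destruct H as [p [e Hp]].
  destruct (zf_separation M HZF p e a) as [b Hb].
  exists b; intro x; rewrite Hb, Hp; tauto.
Qed.

Lemma replacement (R : M -> M -> Prop) a :
  dfn2 R ->
  (forall x y y', x ∈ a -> R x y -> R x y' -> y = y') ->
  exists b, forall y, y ∈ b <-> exists x, x ∈ a /\ R x y.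
Proof.
  intros [p [r Hp]] Hf. destruct (dom_inhabited M) as [c0].
  set (q := rename (fun i => match r i with inl O => 0 | inl _ => 1 | _ => S (S i) end) p).
  set (e := fun i => match r i with inl _ => c0 | inr c => c end).
  assert (Hq : forall x y, R x y <-> sat M (scons x (scons y e)) q).
  { intros x y; unfold q, e.
    rewrite (sat_rename p _ _ (fun i => tm (fun k => match k with O => x | _ => y end) (r i))).
    - apply (Hp (fun k => match k with O => x | _ => y end)).
    - intro k; destruct (r k) as [[|j]|c] eqn:E; simpl; rewrite ?E; reflexivity. }
  destruct (zf_replacement M HZF q e a) as [b Hb].
  { intros x y y' Hx H H'; apply (Hf x); auto; apply Hq; auto. }
  exists b; intro y; rewrite Hb.
  split; intros [x [Hx H]]; exists x; split; auto; apply Hq; auto.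
Qed.

(** Foundation gives a minimal element of the set of counterexamples in [a], which separation
    provides because [P] is definable. *)
Lemma mem_induction (P : M -> Prop) a :
  dfn1 P ->
  (forall x, x ∈ a -> (forall y, y ∈ a -> y ∈ x -> P y) -> P x) ->
  forall x, x ∈ a -> P x.
Proof.
  intros HP Hind x Hx. apply NNPP; intro Hn.
  destruct (separation (fun x => ~ P x) a) as [b Hb]; [dfn_tac|].
  destruct (zf_foundation M HZF b) as [y [Hy Hmin]]; [exists x; apply Hb; auto|].
  apply Hb in Hy; destruct Hy as [Hy HnP]. apply HnP, Hind; auto.
  intros z Hz Hzy. apply NNPP; intro HnPz. apply (Hmin z Hzy), Hb; auto.
Qed.

Lemma mem_irrefl (x : M) : ~ x ∈ x.
Proof.
  intro H. destruct (zf_pairing M HZF x x) as [c Hc].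
  destruct (zf_foundation M HZF c) as [y [Hy Hmin]]; [exists x; apply Hc; auto|].
  assert (y = x) as -> by (apply Hc in Hy; tauto). apply (Hmin x H Hy).
Qed.

Lemma is_upair_inj (c x y z : M) : is_upair c x y -> is_upair c x z -> y = z.
Proof.
  intros H H'.
  destruct (proj1 (H' y) (proj2 (H y) (or_intror eq_refl))); auto.
  destruct (proj1 (H z) (proj2 (H' z) (or_intror eq_refl))); congruence.
Qed.

Lemma is_upair_unique (c c' x y : M) : is_upair c x y -> is_upair c' x y -> c = c'.
Proof. intros H H'; apply (zf_extensionality M HZF); intro z; rewrite (H z), (H' z); tauto. Qed.

Lemma is_opair_inj (c x y x' y' : M) :
  is_opair c x y -> is_opair c x' y' -> x = x' /\ y = y'.
Proof.
  intros [s [t [Hs [Ht Hc]]]] [s' [t' [Hs' [Ht' Hc']]]].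
  assert (x = x') as <-.
  { destruct (proj1 (Hc' s) (proj2 (Hc s) (or_introl eq_refl))) as [-> | ->].
    - destruct (proj1 (Hs' x) (proj2 (Hs x) (or_introl eq_refl))); auto.
    - symmetry; destruct (proj1 (Hs x') (proj2 (Ht' x') (or_introl eq_refl))); auto. }
  split; auto.
  assert (s = s') as <- by apply (is_upair_unique _ _ _ _ Hs Hs').
  assert (t = t') as <- by apply (is_upair_inj _ _ _ _ Hc Hc').
  apply (is_upair_inj _ _ _ _ Ht Ht').
Qed.

Lemma is_opair_unique (c c' x y : M) : is_opair c x y -> is_opair c' x y -> c = c'.
Proof.
  intros [s [t [Hs [Ht Hc]]]] [s' [t' [Hs' [Ht' Hc']]]].
  assert (s = s') as <- by apply (is_upair_unique _ _ _ _ Hs Hs').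
  assert (t = t') as <- by apply (is_upair_unique _ _ _ _ Ht Ht').
  apply (is_upair_unique _ _ _ _ Hc Hc').
Qed.

Lemma opair_exists (x y : M) : exists c, is_opair c x y.
Proof.
  destruct (zf_pairing M HZF x x) as [s Hs], (zf_pairing M HZF x y) as [t Ht].
  destruct (zf_pairing M HZF s t) as [c Hc]. exists c, s, t; auto.
Qed.

Lemma succ_exists (x : M) : exists s, is_succ s x.
Proof.
  destruct (zf_pairing M HZF x x) as [s Hs].
  destruct (zf_pairing M HZF x s) as [t Ht].
  destruct (zf_union M HZF t) as [u Hu]. exists u; intro y; rewrite Hu; split.
  - intros [z [Hy Hz]]; apply Ht in Hz; destruct Hz as [-> | ->]; auto.
    apply Hs in Hy; tauto.
  - intros [Hy | ->]; [exists x | exists s]; split; auto; try apply Hs; auto; apply Ht; auto.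
Qed.

(** Replacement forms each row of pairs with a fixed first coordinate, then the set of all rows; the
    product is its union. *)
Lemma prod_exists (a b : M) : exists p, is_prod p a b.
Proof.
  assert (Hrow : forall x, exists r, forall c, c ∈ r <-> exists y, y ∈ b /\ is_opair c x y).
  { intro x. apply (replacement (fun y c => is_opair c x y)); [dfn_tac|].
    intros y c c' _; apply is_opair_unique. }
  destruct (replacement (fun x r => forall c, c ∈ r <-> exists y, y ∈ b /\ is_opair c x y) a)
    as [rows Hrows]; [dfn_tac| |].
  { intros x r r' _ H H'; apply (zf_extensionality M HZF); intro c; rewrite H, H'; tauto. }
  destruct (zf_union M HZF rows) as [p Hp]. exists p; intro c; rewrite Hp; split.
  - intros [r [Hc Hr]]. apply Hrows in Hr; destruct Hr as [x [Hx Hr]].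
    apply Hr in Hc; destruct Hc as [y [Hy Hc]]; exists x, y; auto.
  - intros [x [y [Hx [Hy Hc]]]]. destruct (Hrow x) as [r Hr].
    exists r; split; [apply Hr; eauto | apply Hrows; eauto].
Qed.

(** The first clause says that [f] consists of pairs only, which [maps] cannot express and
    [is_fun_on] demands. *)
Lemma relation_exists (R : M -> M -> Prop) a b :
  dfn2 R ->
  exists f, (forall c, c ∈ f -> exists x y, x ∈ a /\ is_opair c x y) /\
    forall x y, maps f x y <-> (x ∈ a /\ y ∈ b /\ R x y).
Proof.
  intro HR. destruct (prod_exists a b) as [p Hp].
  destruct (separation (fun c => exists x y, is_opair c x y /\ R x y) p) as [f Hf]; [dfn_tac|].
  exists f; split.
  - intros c Hc; apply Hf in Hc; destruct Hc as [Hc _]; apply Hp in Hc.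
    destruct Hc as [x [y [Hx [_ Hc]]]]; eauto.
  - intros x y; split.
    + intros [c [Hc Hcf]]. apply Hf in Hcf; destruct Hcf as [Hcp [x' [y' [Hc' H]]]].
      destruct (is_opair_inj _ _ _ _ _ Hc Hc') as [-> ->].
      apply Hp in Hcp; destruct Hcp as [x'' [y'' [Hx [Hy Hc'']]]].
      destruct (is_opair_inj _ _ _ _ _ Hc Hc'') as [-> ->]. auto.
    + intros [Hx [Hy H]]. destruct (opair_exists x y) as [c Hc].
      exists c; split; auto. apply Hf; split; [apply Hp|]; eauto.
Qed.

Lemma function_exists (R : M -> M -> Prop) a b :
  dfn2 R ->
  (forall x, x ∈ a -> exists y, y ∈ b /\ R x y) ->
  (forall x y y', x ∈ a -> y ∈ b -> y' ∈ b -> R x y -> R x y' -> y = y') ->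
  exists f, is_fun f a b /\ forall x y, maps f x y <-> (x ∈ a /\ y ∈ b /\ R x y).
Proof.
  intros HR Htot Hfun. destruct (relation_exists R a b HR) as [f [Hdom Hf]].
  exists f; split; auto. split; [split; auto|].
  - intros x Hx. destruct (Htot x Hx) as [y [Hy H]]. exists y; split; [apply Hf; auto|].
    intros y' H'; apply Hf in H'; destruct H' as [_ [Hy' H']]; eauto.
  - intros x y H; apply Hf in H; tauto.
Qed.

Lemma is_fun_dom (f a b x y : M) : is_fun f a b -> maps f x y -> x ∈ a.
Proof.
  intros [[H _] _] [c [Hc Hcf]]. destruct (H c Hcf) as [x' [y' [Hx Hc']]].
  destruct (is_opair_inj _ _ _ _ _ Hc Hc') as [-> _]; auto.
Qed.

Lemma is_fun_unique (f a b x y y' : M) : is_fun f a b -> maps f x y -> maps f x y' -> y = y'.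
Proof.
  intros Hf H H'. pose proof (is_fun_dom _ _ _ _ _ Hf H) as Hx.
  destruct Hf as [[_ Hf] _]. destruct (Hf x Hx) as [z [_ Hz]].
  rewrite <- (Hz y H); auto.
Qed.

Lemma is_fun_total (f a b x : M) : is_fun f a b -> x ∈ a -> exists y, y ∈ b /\ maps f x y.
Proof.
  intros [[_ Hf] Hb] Hx. destruct (Hf x Hx) as [y [Hy _]]; eauto.
Qed.

Lemma inj_exists (R : M -> M -> Prop) a b :
  dfn2 R ->
  (forall x, x ∈ a -> exists y, y ∈ b /\ R x y) ->
  (forall x y y', x ∈ a -> y ∈ b -> y' ∈ b -> R x y -> R x y' -> y = y') ->
  (forall x x' y, x ∈ a -> x' ∈ a -> y ∈ b -> R x y -> R x' y -> x = x') ->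
  exists f, is_inj f a b.
Proof.
  intros HR Htot Hfun Hinj. destruct (function_exists R a b HR Htot Hfun) as [f [Hf Hm]].
  exists f; split; auto. intros x x' y H H'; apply Hm in H, H'.
  apply (Hinj x x' y); tauto.
Qed.

Lemma equipotent_exists (R : M -> M -> Prop) a b :
  dfn2 R ->
  (forall x, x ∈ a -> exists y, y ∈ b /\ R x y) ->
  (forall x y y', x ∈ a -> y ∈ b -> y' ∈ b -> R x y -> R x y' -> y = y') ->
  (forall x x' y, x ∈ a -> x' ∈ a -> y ∈ b -> R x y -> R x' y -> x = x') ->
  (forall y, y ∈ b -> exists x, x ∈ a /\ R x y) ->
  equipotent a b.
Proof.
  intros HR Htot Hfun Hinj Hsurj.
  destruct (function_exists R a b HR Htot Hfun) as [f [Hf Hm]].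
  exists f; split; split; auto.
  - intros x x' y H H'; apply Hm in H, H'. apply (Hinj x x' y); tauto.
  - intros y Hy. destruct (Hsurj y Hy) as [x [Hx H]]. exists x; apply Hm; auto.
Qed.

Lemma psurj_exists (R : M -> M -> Prop) x a :
  dfn2 R ->
  (forall u v v', u ∈ x -> v ∈ a -> v' ∈ a -> R u v -> R u v' -> v = v') ->
  (forall v, v ∈ a -> exists u, u ∈ x /\ R u v) ->
  psurj x a.
Proof.
  intros HR Hfun Hsurj. destruct (relation_exists R x a HR) as [g [_ Hg]].
  exists g; split.
  - intros u v v' Hu H H'; apply Hg in H, H'. apply (Hfun u); tauto.
  - intros v Hv; destruct (Hsurj v Hv) as [u [Hu H]]; exists u; split; auto; apply Hg; auto.
Qed.

Lemma psurj_iff (x a : M) : psurj x a <-> (is_empty a \/ exists f, is_surj f x a).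
Proof.
  split.
  - intros [g [Hfun Hsurj]].
    destruct (classic (exists v, v ∈ a)) as [[v0 Hv0] | Hn]; [right|left; intros v Hv; eauto].
    (* The partial map becomes total by sending every point without a value in [a] to the fixed
       element [v0]. *)
    destruct (function_exists (fun u v =>
        maps g u v \/ ((forall w, w ∈ a -> ~ maps g u w) /\ v = v0)) x a) as [f [Hf Hm]].
    + dfn_tac.
    + intros u Hu. destruct (classic (exists w, w ∈ a /\ maps g u w)) as [[w [Hw H]] | Hn].
      * eauto.
      * exists v0; split; auto; right; split; auto; intros w Hw H; eauto.
    + intros u v v' Hu Hv Hv' [H | [H ->]] [H' | [H' ->]]; auto.
      * apply (Hfun u); auto.
      * elim (H' v Hv H).
      * elim (H v' Hv' H').
    + exists f; split; auto. intros v Hv. destruct (Hsurj v Hv) as [u [Hu H]].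
      exists u; apply Hm; auto.
  - intros [He | [f [Hf Hs]]].
    + apply (psurj_exists eq); [dfn_tac | |]; intros; [congruence|]. elim (He v); auto.
    + exists f; split.
      * intros u v v' _; apply (is_fun_unique _ _ _ _ _ _ Hf).
      * intros v Hv; destruct (Hs v Hv) as [u H]; exists u; split; auto.
        apply (is_fun_dom _ _ _ _ _ Hf H).
Qed.

(** * Equipotence and independence of representatives *)

Lemma equipotent_refl (a : M) : equipotent a a.
Proof. apply (equipotent_exists eq); [dfn_tac | ..]; intros; eauto; congruence. Qed.

Lemma equipotent_sym (a b : M) : equipotent a b -> equipotent b a.
Proof.
  intros [f [[Hf Hi] [_ Hs]]].
  apply (equipotent_exists (fun y x => maps f x y)); [dfn_tac | ..].
  - intros y Hy. destruct (Hs y Hy) as [x H]; exists x; split; auto.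
    apply (is_fun_dom _ _ _ _ _ Hf H).
  - intros y x x' _ _ _; apply Hi.
  - intros y y' x _ _ _; apply (is_fun_unique _ _ _ _ _ _ Hf).
  - intros x Hx; apply (is_fun_total _ _ _ _ Hf Hx).
Qed.

Lemma is_inj_trans (a b c f g : M) : is_inj f a b -> is_inj g b c ->
  exists h, is_inj h a c.
Proof.
  intros [Hf Hfi] [Hg Hgi].
  apply (inj_exists (fun x z => exists y, maps f x y /\ maps g y z)); [dfn_tac | ..].
  - intros x Hx. destruct (is_fun_total _ _ _ _ Hf Hx) as [y [Hy H]].
    destruct (is_fun_total _ _ _ _ Hg Hy) as [z [Hz H']]; eauto.
  - intros x z z' _ _ _ [y [H1 H2]] [y' [H3 H4]].
    assert (y = y') as <- by apply (is_fun_unique _ _ _ _ _ _ Hf H1 H3).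
    apply (is_fun_unique _ _ _ _ _ _ Hg H2 H4).
  - intros x x' z _ _ _ [y [H1 H2]] [y' [H3 H4]].
    assert (y = y') as <- by apply (Hgi _ _ _ H2 H4). apply (Hfi _ _ _ H1 H3).
Qed.

Lemma psurj_trans (a b c : M) : psurj a b -> psurj b c -> psurj a c.
Proof.
  intros [f [Hf Hfs]] [g [Hg Hgs]].
  (* The condition [y ∈ b] matters: [f] may take values outside [b], where [g] need not be
     single-valued. *)
  apply (psurj_exists (fun x z => exists y, y ∈ b /\ maps f x y /\ maps g y z)); [dfn_tac | ..].
  - intros x z z' Hx _ _ [y [Hy [H1 H2]]] [y' [_ [H3 H4]]].
    assert (y = y') as <- by apply (Hf _ _ _ Hx H1 H3). apply (Hg _ _ _ Hy H2 H4).
  - intros z Hz. destruct (Hgs z Hz) as [y [Hy H]].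
    destruct (Hfs y Hy) as [x [Hx H']]. eauto 7.
Qed.

Lemma equipotent_trans (a b c : M) : equipotent a b -> equipotent b c -> equipotent a c.
Proof.
  intros [f [[Hf Hfi] [_ Hfs]]] [g [[Hg Hgi] [_ Hgs]]].
  apply (equipotent_exists (fun x z => exists y, maps f x y /\ maps g y z)); [dfn_tac | ..].
  - intros x Hx. destruct (is_fun_total _ _ _ _ Hf Hx) as [y [Hy H]].
    destruct (is_fun_total _ _ _ _ Hg Hy) as [z [Hz H']]; eauto.
  - intros x z z' _ _ _ [y [H1 H2]] [y' [H3 H4]].
    assert (y = y') as <- by apply (is_fun_unique _ _ _ _ _ _ Hf H1 H3).
    apply (is_fun_unique _ _ _ _ _ _ Hg H2 H4).
  - intros x x' z _ _ _ [y [H1 H2]] [y' [H3 H4]].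
    assert (y = y') as <- by apply (Hgi _ _ _ H2 H4). apply (Hfi _ _ _ H1 H3).
  - intros z Hz. destruct (Hgs z Hz) as [y H].
    destruct (Hfs y (is_fun_dom _ _ _ _ _ Hg H)) as [x H'].
    exists x; split; eauto. apply (is_fun_dom _ _ _ _ _ Hf H').
Qed.

Lemma card_eq_iff (a b : M) : card a = card b <-> equipotent a b.
Proof.
  split; intro H.
  - change (card a b); rewrite H; apply equipotent_refl.
  - apply functional_extensionality; intro z; apply propositional_extensionality.
    unfold card; split; intro H'.
    + apply (equipotent_trans _ a); auto; apply equipotent_sym; auto.
    + apply (equipotent_trans _ b); auto.
Qed.

Lemma card_le_iff (a x : M) : card_le (card a) (card x) <-> exists f, is_inj f a x.
Proof.
  split.
  - intros [a' [x' [Ha [Hx H]]]].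
    apply card_eq_iff in Ha, Hx; apply equipotent_sym in Hx.
    destruct Ha as [f [Hf _]], Hx as [k [Hk _]].
    destruct H as [He | [g Hg]].
    (* If [a'] is empty, so is [a], and [f] is vacuously a map into [x]. *)
    + exists f; destruct Hf as [Hf Hi]; split; auto. destruct Hf as [Hf Hb]; split; auto.
      intros u v H; elim (He v); eauto.
    + destruct (is_inj_trans _ _ _ _ _ Hf Hg) as [h Hh].
      apply (is_inj_trans _ _ _ _ _ Hh Hk).
  - intros H; exists a, x; auto.
Qed.

Lemma card_le_star_iff (a x : M) : card_le_star (card a) (card x) <-> psurj x a.
Proof.
  split.
  - intros [a' [x' [Ha [Hx H]]]].
    apply card_eq_iff in Ha, Hx; apply equipotent_sym in Ha.
    destruct Ha as [f [_ Hf]], Hx as [k [_ Hk]].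
    apply (psurj_trans _ a'); [|apply psurj_iff; eauto].
    apply (psurj_trans _ x'); apply psurj_iff; eauto.
  - intros H; exists a, x; split; [|split]; auto. apply psurj_iff; auto.
Qed.

(** Since [card_mul] ranges over all representatives, bijections between the factors are combined
    coordinatewise into one between the products. *)
Lemma card_mul_card (a b p : M) : is_prod p a b -> card_mul (card a) (card b) = card p.
Proof.
  intro Hp. apply functional_extensionality; intro z; apply propositional_extensionality.
  split; [|intro H; exists a, b, p; auto].
  intros [a' [b' [p' [Ha [Hb [Hp' Hz]]]]]].
  enough (card p = card p') as -> by auto.
  apply card_eq_iff in Ha, Hb. apply card_eq_iff.
  destruct Ha as [f [[Hf Hfi] [_ Hfs]]], Hb as [g [[Hg Hgi] [_ Hgs]]].
  apply (equipotent_exists (fun c c' => exists x y x' y',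
    is_opair c x y /\ is_opair c' x' y' /\ maps f x x' /\ maps g y y')); [dfn_tac | ..].
  - intros c Hc. apply Hp in Hc; destruct Hc as [x [y [Hx [Hy Hc]]]].
    destruct (is_fun_total _ _ _ _ Hf Hx) as [x' [Hx' H]].
    destruct (is_fun_total _ _ _ _ Hg Hy) as [y' [Hy' H']].
    destruct (opair_exists x' y') as [c' Hc'].
    exists c'; split; [apply Hp' | exists x, y, x', y']; eauto 6.
  - intros c c1 c2 _ _ _ [x [y [x' [y' [H1 [H2 [H3 H4]]]]]]] [u [v [u' [v' [K1 [K2 [K3 K4]]]]]]].
    destruct (is_opair_inj _ _ _ _ _ H1 K1) as [-> ->].
    assert (x' = u') as -> by apply (is_fun_unique _ _ _ _ _ _ Hf H3 K3).
    assert (y' = v') as -> by apply (is_fun_unique _ _ _ _ _ _ Hg H4 K4).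
    apply (is_opair_unique _ _ _ _ H2 K2).
  - intros c1 c2 c _ _ _ [x [y [x' [y' [H1 [H2 [H3 H4]]]]]]] [u [v [u' [v' [K1 [K2 [K3 K4]]]]]]].
    destruct (is_opair_inj _ _ _ _ _ H2 K2) as [-> ->].
    assert (x = u) as -> by apply (Hfi _ _ _ H3 K3).
    assert (y = v) as -> by apply (Hgi _ _ _ H4 K4).
    apply (is_opair_unique _ _ _ _ H1 K1).
  - intros c' Hc'. apply Hp' in Hc'; destruct Hc' as [x' [y' [Hx' [Hy' Hc']]]].
    destruct (Hfs x' Hx') as [x H], (Hgs y' Hy') as [y H'].
    destruct (opair_exists x y) as [c Hc].
    exists c; split; [apply Hp | exists x, y, x', y'; auto].
    exists x, y; split; [|split]; auto; eapply is_fun_dom; eauto.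
Qed.

(** * Ordinals *)

(** Foundation supplies irreflexivity and least elements, so transitivity and comparability remain
    to be checked. *)
Lemma is_ord_intro (a : M) :
  (forall x, x ∈ a -> subset x a) ->
  (forall x y z, z ∈ a -> y ∈ z -> x ∈ y -> x ∈ z) ->
  (forall x y, x ∈ a -> y ∈ a -> x ∈ y \/ x = y \/ y ∈ x) ->
  is_ord a.
Proof.
  intros Ht He Hc. split; [|split; [|split; [|split]]]; auto.
  - intros x _; apply mem_irrefl.
  - intros x y z _ _ Hz Hxy Hyz; eauto.
  - intros b Hb Hn. destruct (zf_foundation M HZF b Hn) as [x [Hx Hmin]].
    exists x; split; auto. intros y Hy.
    destruct (Hc x y (Hb x Hx) (Hb y Hy)) as [H | [H | H]]; auto.
    elim (Hmin y H Hy).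
Qed.

Lemma is_ord_mem_trans (a x y : M) : is_ord a -> x ∈ a -> y ∈ x -> y ∈ a.
Proof. intros [H _] Hx; apply (H x Hx). Qed.

Lemma is_ord_elem_trans (a x y z : M) : is_ord a -> z ∈ a -> y ∈ z -> x ∈ y -> x ∈ z.
Proof.
  intros Ha Hz Hy Hx. assert (y ∈ a) by (eapply is_ord_mem_trans; eauto).
  assert (x ∈ a) by (eapply is_ord_mem_trans; eauto).
  destruct Ha as [_ [_ [H1 _]]]. eauto.
Qed.

Lemma is_ord_linear (a x y : M) : is_ord a -> x ∈ a -> y ∈ a -> x ∈ y \/ x = y \/ y ∈ x.
Proof. intros [_ [_ [_ [H _]]]]; auto. Qed.

Lemma is_ord_elem (a x : M) : is_ord a -> x ∈ a -> is_ord x.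
Proof.
  intros Ha Hx. apply is_ord_intro.
  - intros y Hy z Hz; eapply is_ord_elem_trans; eauto.
  - intros u y z Hz; apply (is_ord_elem_trans a); auto; eapply is_ord_mem_trans; eauto.
  - intros y z Hy Hz; apply (is_ord_linear a); auto; eapply is_ord_mem_trans; eauto.
Qed.

(** If [b] has elements outside [a], a minimal one of them has exactly the elements of [a], hence
    equals [a]. *)
Lemma ord_le_subset (a b : M) : is_ord a -> is_ord b -> subset a b -> ord_le a b.
Proof.
  intros Ha Hb Hs. destruct (separation (fun x => ~ x ∈ a) b) as [d Hd]; [dfn_tac|].
  destruct (classic (exists x, x ∈ d)) as [Hn | Hn].
  - left. destruct (zf_foundation M HZF d Hn) as [x [Hx Hmin]].
    apply Hd in Hx; destruct Hx as [Hx Hxa]. replace a with x; auto.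
    apply (zf_extensionality M HZF); intro y; split; intro Hy.
    + apply NNPP; intro Hya. apply (Hmin y Hy), Hd; split; auto.
      apply (is_ord_mem_trans b x); auto.
    + destruct (is_ord_linear b x y Hb Hx (Hs y Hy)) as [H | [-> | H]]; auto; [|tauto].
      elim Hxa; apply (is_ord_mem_trans a y); auto.
  - right. apply (zf_extensionality M HZF); intro x; split; auto.
    intro Hx; apply NNPP; intro Hxa; apply Hn; exists x; apply Hd; auto.
Qed.

Lemma ord_le_mem (a b x : M) : is_ord b -> ord_le a b -> x ∈ a -> x ∈ b.
Proof. intros Hb [H | ->] Hx; auto; apply (is_ord_mem_trans b a); auto. Qed.

(** The intersection [c] is an ordinal; were it a member of both [a] and [b], it would be a member
    of itself. *)
Lemma ord_trichotomy (a b : M) : is_ord a -> is_ord b -> a ∈ b \/ a = b \/ b ∈ a.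
Proof.
  intros Ha Hb. destruct (separation (fun x => x ∈ b) a) as [c Hc]; [dfn_tac|].
  assert (Hco : is_ord c).
  { apply is_ord_intro.
    - intros x Hx y Hy. apply Hc in Hx; apply Hc; split; eapply is_ord_mem_trans; eauto; tauto.
    - intros x y z Hz; apply Hc in Hz; apply (is_ord_elem_trans a); tauto.
    - intros x y Hx Hy; apply Hc in Hx, Hy; apply (is_ord_linear a); tauto. }
  destruct (ord_le_subset c a) as [H | <-]; auto; [intros x Hx; apply Hc in Hx; tauto| |];
  destruct (ord_le_subset c b) as [H' | H']; auto; try (intros x Hx; apply Hc in Hx; tauto).
  - elim (mem_irrefl c); apply Hc; auto.
  - subst; auto.
Qed.

Lemma is_ord_of_transitive (a : M) :
  (forall x, x ∈ a -> subset x a) -> (forall x, x ∈ a -> is_ord x) -> is_ord a.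
Proof.
  intros Ht Ho; apply is_ord_intro; auto.
  - intros x y z Hz Hy Hx; apply (is_ord_mem_trans z y); auto.
  - intros x y Hx Hy; apply ord_trichotomy; auto.
Qed.

(* An ordinal [a] with [g : x -> a] onto is determined by [W = {g^-1[b] : b ∈ a}],
   a chain of subsets of [x] of order type [a]. *)
Lemma subset_of_preimages (x W a a' g g' : M) :
  is_ord a -> is_ord a' ->
  (forall u v v', u ∈ x -> maps g u v -> maps g u v' -> v = v') ->
  (forall u v v', u ∈ x -> maps g' u v -> maps g' u v' -> v = v') ->
  (forall v, v ∈ a -> exists u, u ∈ x /\ maps g u v) ->
  (forall v, v ∈ a' -> exists u, u ∈ x /\ maps g' u v) ->
  (forall w, w ∈ W <-> exists b, b ∈ a /\
     forall u, u ∈ w <-> (u ∈ x /\ exists c, c ∈ b /\ maps g u c)) ->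
  (forall w, w ∈ W <-> exists b, b ∈ a' /\
     forall u, u ∈ w <-> (u ∈ x /\ exists c, c ∈ b /\ maps g' u c)) ->
  subset a a'.
Proof.
  intros Ha Ha' Hg Hg' Hs Hs' HW HW'.
  pose (pre := fun f b u => u ∈ x /\ exists c : M, c ∈ b /\ maps f u c).
  assert (Hmono : forall f o b d, is_ord o -> d ∈ o -> b ∈ d ->
    forall u, pre f b u -> pre f d u).
  { intros f o b d Ho Hd Hb u [Hu [c [Hc H]]]. split; auto. exists c; split; auto.
    apply (is_ord_elem_trans o c b d); auto. }
  (* A point that [f] sends to [b] lies in the preimage of [d] but not in that of [b]. *)
  assert (Hstrict : forall f o b d,
    (forall u v v', u ∈ x -> maps f u v -> maps f u v' -> v = v') ->
    (forall v, v ∈ o -> exists u, u ∈ x /\ maps f u v) ->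
    is_ord o -> d ∈ o -> b ∈ d -> ~ (forall u, pre f d u -> pre f b u)).
  { intros f o b d Hf Hfs Ho Hd Hb H.
    destruct (Hfs b) as [u [Hu Hub]]; [apply (is_ord_mem_trans o d); auto|].
    destruct (H u) as [_ [c [Hc Huc]]]; [split; eauto|].
    rewrite (Hf u c b Hu Huc Hub) in Hc. apply (mem_irrefl b Hc). }
  (* The two descriptions of [W] match each element of one ordinal with an element of the other
     having the same preimage; the induction below shows that matched elements are equal. *)
  assert (Hto : forall b, b ∈ a -> exists b', b' ∈ a' /\ forall u, pre g b u <-> pre g' b' u).
  { intros b Hb. destruct (separation (fun u => exists c, c ∈ b /\ maps g u c) x) as [w Hw];
      [dfn_tac|].
    assert (w ∈ W) as H by (apply HW; eauto).
    apply HW' in H; destruct H as [b' [Hb' H]]. exists b'; split; auto.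
    intro u; unfold pre; rewrite <- Hw, H; tauto. }
  assert (Hfrom : forall b, b ∈ a' -> exists b', b' ∈ a /\ forall u, pre g b' u <-> pre g' b u).
  { intros b Hb. destruct (separation (fun u => exists c, c ∈ b /\ maps g' u c) x) as [w Hw];
      [dfn_tac|].
    assert (w ∈ W) as H by (apply HW'; eauto).
    apply HW in H; destruct H as [b' [Hb' H]]. exists b'; split; auto.
    intro u; unfold pre; rewrite <- Hw, H; tauto. }
  enough (forall b, b ∈ a -> b ∈ a' /\ forall u, pre g b u <-> pre g' b u)
    by (intros b Hb; apply H; auto).
  apply (mem_induction (fun b => b ∈ a' /\ forall u, pre g b u <-> pre g' b u)).
  { unfold pre; dfn_tac. }
  intros b Hb IH. destruct (Hto b Hb) as [b' [Hb' H]].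
  destruct (ord_trichotomy b b') as [Hbb | [<- | Hbb]];
    [apply (is_ord_elem a); auto | apply (is_ord_elem a'); auto | | auto | ].
  - assert (Hba : b ∈ a') by (apply (is_ord_mem_trans a' b'); auto).
    split; auto. destruct (Hfrom b Hba) as [d [Hd K]].
    (* Here [d] is the partner of [b] in [a]. If [d ∈ b], induction makes two preimages under [g']
       equal, against strictness; if [b ∈ d], the preimage of [b'] under [g'] would lie in that of
       its element [b]. *)
    destruct (ord_trichotomy d b) as [Hdb | [-> | Hdb]];
      [apply (is_ord_elem a); auto | apply (is_ord_elem a); auto | | auto | ].
    + destruct (IH d Hd Hdb) as [_ E].
      elim (Hstrict g' a' d b Hg' Hs' Ha' Hba Hdb). intros u Hu; apply E, K, Hu.
    + elim (Hstrict g' a' b b' Hg' Hs' Ha' Hb' Hbb).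
      intros u Hu. apply K, (Hmono g a b d), H; auto.
  - assert (Hba : b' ∈ a) by (apply (is_ord_mem_trans a b); auto).
    destruct (IH b' Hba Hbb) as [_ E].
    elim (Hstrict g a b' b Hg Hs Ha Hb Hbb). intros u Hu; apply E, H, Hu.
Qed.

(** * Lindenbaum and Hartogs numbers as sets, and their suprema *)

Lemma lindenbaum_exists (x : M) : exists h, forall a, a ∈ h <-> (is_ord a /\ psurj x a).
Proof.
  destruct (zf_powerset M HZF x) as [P1 HP1], (zf_powerset M HZF P1) as [P2 HP2].
  (* By [subset_of_preimages] a chain [W] of subsets of [x] determines its ordinal, so the ordinals
     sought are the image of a part of the double power set. *)
  destruct (replacement (fun W a => is_ord a /\ exists g,
    (forall u v v', u ∈ x -> maps g u v -> maps g u v' -> v = v') /\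
    (forall v, v ∈ a -> exists u, u ∈ x /\ maps g u v) /\
    (forall w, w ∈ W <-> exists b, b ∈ a /\
       forall u, u ∈ w <-> (u ∈ x /\ exists c, c ∈ b /\ maps g u c))) P2) as [h Hh].
  - dfn_tac.
  - intros W a a' _ [Ha [g [Hg [Hs HW]]]] [Ha' [g' [Hg' [Hs' HW']]]].
    assert (H1 := subset_of_preimages x W a a' g g' Ha Ha' Hg Hg' Hs Hs' HW HW').
    assert (H2 := subset_of_preimages x W a' a g' g Ha' Ha Hg' Hg Hs' Hs HW' HW).
    apply (zf_extensionality M HZF); intro y; split; auto.
  - exists h; intro a; rewrite Hh; split.
    + intros [W [_ [Ha [g [Hg [Hs _]]]]]]; split; auto; exists g; auto.
    + intros [Ha [g [Hg Hs]]].
      destruct (separation (fun w => exists b, b ∈ a /\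
        forall u, u ∈ w <-> (u ∈ x /\ exists c, c ∈ b /\ maps g u c)) P1) as [W HW]; [dfn_tac|].
      exists W; split; [|split; auto; exists g; split; [|split]; auto].
      * apply HP2; intros w Hw; apply HW in Hw; tauto.
      * intro w; rewrite HW; split; [tauto|]. intro H; split; auto.
        destruct H as [b [_ H]]. apply HP1; intros u Hu; apply H in Hu; tauto.
Qed.

Lemma the_spec (P : M -> Prop) : (exists h, P h) -> P (the P).
Proof. exact (epsilon_spec (dom_inhabited M) P). Qed.

Lemma mem_aleph_star (x a : M) : a ∈ aleph_star (card x) <-> (is_ord a /\ psurj x a).
Proof.
  rewrite <- card_le_star_iff. revert a. unfold aleph_star.
  apply (the_spec (fun h => forall a, a ∈ h <-> is_ord a /\ card_le_star (card a) (card x))).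
  destruct (lindenbaum_exists x) as [h Hh]; exists h; intro a.
  rewrite card_le_star_iff; apply Hh.
Qed.

Lemma psurj_of_inj (f a x : M) : is_inj f a x -> psurj x a.
Proof.
  intros [Hf Hi]. apply (psurj_exists (fun u v => maps f v u)); [dfn_tac| |].
  - intros u v v' _ _ _; apply Hi.
  - intros v Hv; apply (is_fun_total _ _ _ _ Hf Hv).
Qed.

(** The inverse of an injection is a partial surjection, so the Hartogs number can be separated from
    the Lindenbaum number. *)
Lemma mem_aleph (x a : M) : a ∈ aleph (card x) <-> (is_ord a /\ exists f, is_inj f a x).
Proof.
  rewrite <- card_le_iff. revert a. unfold aleph.
  apply (the_spec (fun h => forall a, a ∈ h <-> is_ord a /\ card_le (card a) (card x))).
  destruct (lindenbaum_exists x) as [h Hh].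
  destruct (separation (fun a => exists f, is_inj f a x) h) as [k Hk]; [dfn_tac|].
  exists k; intro a. rewrite card_le_iff, Hk, Hh. split; [tauto|].
  intros [Ha [f Hf]]; split; eauto. split; auto. apply (psurj_of_inj f); auto.
Qed.

(** For transitivity the same [g] serves for every [b ∈ a], because [psurj] allows values outside
    its target. *)
Lemma aleph_star_ord (x : M) : is_ord (aleph_star (card x)).
Proof.
  apply is_ord_of_transitive; intros a Ha; apply mem_aleph_star in Ha; [|tauto].
  destruct Ha as [Ha [g [Hg Hs]]]. intros b Hb; apply mem_aleph_star.
  split; [eapply is_ord_elem; eauto|]. exists g; split; auto.
  intros v Hv; apply Hs; apply (is_ord_mem_trans a b); auto.
Qed.

Lemma aleph_ord (x : M) : is_ord (aleph (card x)).
Proof.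
  apply is_ord_of_transitive; intros a Ha; apply mem_aleph in Ha; [|tauto].
  destruct Ha as [Ha [f [Hf Hi]]]. intros b Hb; apply mem_aleph.
  split; [eapply is_ord_elem; eauto|].
  apply (inj_exists (fun u v => maps f u v)); [dfn_tac| | |].
  - intros u Hu; apply (is_fun_total f a); auto; apply (is_ord_mem_trans a b); auto.
  - intros u v v' _ _ _; apply (is_fun_unique _ _ _ _ _ _ Hf).
  - intros u u' v _ _ _; apply Hi.
Qed.

Lemma aleph_le_aleph_star (x : M) : subset (aleph (card x)) (aleph_star (card x)).
Proof.
  intros a Ha; apply mem_aleph in Ha; destruct Ha as [Ha [f Hf]].
  apply mem_aleph_star; split; auto. apply (psurj_of_inj f); auto.
Qed.

(* The supremum is the union, cut out of the bound [b] by separation. *)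
Lemma ord_sup_spec (L : (M -> Prop) -> Prop) (F : (M -> Prop) -> M) (b : M) :
  (forall c, L c -> is_cardinal c) ->
  (forall x, is_ord (F (card x))) ->
  dfn1 (fun a => exists x, L (card x) /\ a ∈ F (card x)) ->
  is_ord b -> (forall l, L l -> subset (F l) b) ->
  is_sup (fun a => exists l, L l /\ a = F l) (ord_sup L F).
Proof.
  intros HL HF Hdef Hb Hsub. unfold ord_sup. apply the_spec.
  destruct (separation (fun a => exists x, L (card x) /\ a ∈ F (card x)) b Hdef) as [s Hs].
  (* Every [F l] is included in [b], so cutting down to [b] loses nothing. *)
  assert (Hs' : forall a, a ∈ s <-> exists x, L (card x) /\ a ∈ F (card x)).
  { intro a; rewrite Hs; split; [tauto|]. intro H; split; auto.
    destruct H as [x [Hx Ha]]; apply (Hsub (card x)); auto. }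
  assert (Hso : is_ord s).
  { apply is_ord_of_transitive; intros a Ha; apply Hs' in Ha; destruct Ha as [x [Hx Ha]].
    - intros c Hc; apply Hs'; exists x; split; auto.
      apply (is_ord_mem_trans _ a); auto.
    - apply (is_ord_elem (F (card x))); auto. }
  exists s; split; [|split]; auto.
  - intros a [l [Hl ->]]. destruct (HL l Hl) as [x ->].
    apply ord_le_subset; auto. intros c Hc; apply Hs'; eauto.
  - intros t Ht Hle. apply ord_le_subset; auto.
    intros a Ha; apply Hs' in Ha; destruct Ha as [x [Hx Ha]].
    apply (ord_le_mem (F (card x))); eauto.
Qed.

(** * Enumerating sets of ordinals *)

(** The set [h] that witnesses the collapse at [x] also witnesses it at all members of [B] below
    [x], so the recursion can be stated without [h]. *)
Lemma collapse_unfold (B b x : M) : collapse B b x ->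
  x ∈ B /\
  (forall d, d ∈ b -> exists z, z ∈ B /\ z ∈ x /\ collapse B d z) /\
  (forall z, z ∈ B -> z ∈ x -> exists d, d ∈ b /\ collapse B d z).
Proof.
  intros [h [Hbx Hh]]. destruct (Hh b x Hbx) as [Hx [H1 H2]].
  split; [|split]; auto.
  - intros d Hd; destruct (H1 d Hd) as [z [Hz [Hzx H]]].
    exists z; split; [|split]; auto; exists h; auto.
  - intros z Hz Hzx; destruct (H2 z Hz Hzx) as [d [Hd H]].
    exists d; split; auto; exists h; auto.
Qed.

(** By induction on [x], both [b] and [b'] consist of the collapses of the members of [B] below
    [x]. *)
Lemma collapse_fun (B b b' x : M) : collapse B b x -> collapse B b' x -> b = b'.
Proof.
  intros H H'. pose proof (proj1 (collapse_unfold _ _ _ H)) as Hx.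
  revert b b' H H'.
  apply (mem_induction (fun x => forall b b', collapse B b x -> collapse B b' x -> b = b') B);
    auto.
  { unfold collapse; dfn_tac. }
  clear x Hx; intros x Hx IH b b' H H'.
  apply collapse_unfold in H, H'. destruct H as [_ [H1 H2]], H' as [_ [H1' H2']].
  apply (zf_extensionality M HZF); intro d; split; intro Hd.
  - destruct (H1 d Hd) as [z [Hz [Hzx H]]]. destruct (H2' z Hz Hzx) as [d' [Hd' H']].
    rewrite (IH z Hz Hzx d d' H H'); auto.
  - destruct (H1' d Hd) as [z [Hz [Hzx H]]]. destruct (H2 z Hz Hzx) as [d' [Hd' H']].
    rewrite (IH z Hz Hzx d d' H H'); auto.
Qed.

Section Collapse.
Context (a B : M) (Ha : is_ord a) (HB : subset B a).

Lemma collapse_lt (b b' x x' : M) :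
  collapse B b x -> collapse B b' x' -> x ∈ x' -> b ∈ b'.
Proof.
  intros H H' Hxx. pose proof (proj1 (collapse_unfold _ _ _ H)) as Hx.
  apply collapse_unfold in H'; destruct H' as [_ [_ H']].
  destruct (H' x Hx Hxx) as [d [Hd K]]. rewrite (collapse_fun _ _ _ _ H K); auto.
Qed.

(** The collapse is strictly increasing and [B] is linearly ordered, being a subset of the ordinal
    [a]. *)
Lemma collapse_inj (b x x' : M) : collapse B b x -> collapse B b x' -> x = x'.
Proof.
  intros H H'. pose proof (proj1 (collapse_unfold _ _ _ H)) as Hx.
  pose proof (proj1 (collapse_unfold _ _ _ H')) as Hx'.
  destruct (is_ord_linear a x x' Ha (HB x Hx) (HB x' Hx')) as [K | [K | K]]; auto.
  - elim (mem_irrefl b (collapse_lt _ _ _ _ H H' K)).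
  - elim (mem_irrefl b (collapse_lt _ _ _ _ H' H K)).
Qed.

Lemma collapse_transitive (b x c d : M) : collapse B b x -> c ∈ b -> d ∈ c -> d ∈ b.
Proof.
  intros H Hc Hd. pose proof (proj1 (collapse_unfold _ _ _ H)) as Hx.
  destruct (proj1 (proj2 (collapse_unfold _ _ _ H)) c Hc) as [z [Hz [Hzx K]]].
  destruct (proj1 (proj2 (collapse_unfold _ _ _ K)) d Hd) as [y [Hy [Hyz K']]].
  apply (collapse_lt _ _ _ _ K' H). apply (is_ord_elem_trans a y z x); auto.
Qed.

(** The elements of [b] are themselves collapses of members of [B], so comparability carries over
    from [a]. *)
Lemma collapse_ord (b x : M) : collapse B b x -> is_ord b.
Proof.
  intro H. pose proof (proj1 (proj2 (collapse_unfold _ _ _ H))) as H1. apply is_ord_intro.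
  - intros c Hc d Hd; apply (collapse_transitive b x c d); auto.
  - intros d c e He Hc Hd. destruct (H1 e He) as [z [_ [_ K]]].
    apply (collapse_transitive e z c d); auto.
  - intros c d Hc Hd. destruct (H1 c Hc) as [z [Hz [_ K]]], (H1 d Hd) as [y [Hy [_ K']]].
    destruct (is_ord_linear a z y Ha (HB z Hz) (HB y Hy)) as [E | [<- | E]].
    + left; apply (collapse_lt _ _ _ _ K K' E).
    + right; left; apply (collapse_fun _ _ _ _ K K').
    + right; right; apply (collapse_lt _ _ _ _ K' K E).
Qed.

Lemma collapse_exists (x : M) : x ∈ B -> exists b, collapse B b x.
Proof.
  apply (mem_induction (fun x => exists b, collapse B b x)); [unfold collapse; dfn_tac|].
  clear x; intros x Hx IH.
  destruct (separation (fun z => z ∈ x) B) as [Bx HBx]; [dfn_tac|].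
  destruct (replacement (fun z d => collapse B d z) Bx) as [b Hb];
    [unfold collapse; dfn_tac | intros z d d' _; apply collapse_fun |].
  (* The witness [h] consists of the pairs already found below [x] and the new pair [(b, x)]; [b1]
     contains all their first coordinates. *)
  destruct (succ_exists b) as [b1 Hb1].
  destruct (relation_exists (fun d z =>
    (z ∈ x /\ collapse B d z) \/ (d = b /\ z = x)) b1 B) as [h [_ Hh]];
    [unfold collapse; dfn_tac|].
  assert (Hlow : forall d z, z ∈ x -> collapse B d z -> d ∈ b /\ maps h d z).
  { intros d z Hz K. pose proof (proj1 (collapse_unfold _ _ _ K)) as HzB.
    assert (d ∈ b) by (apply Hb; exists z; split; auto; apply HBx; auto).
    split; auto. apply Hh; split; [apply Hb1|]; auto. }
  exists b, h; split.
  { apply Hh; split; [apply Hb1|]; auto. }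
  intros c y Hcy. apply Hh in Hcy. destruct Hcy as [_ [Hy [[Hyx K] | [-> ->]]]]; split; auto.
  - destruct (collapse_unfold _ _ _ K) as [_ [K1 K2]]. split.
    + intros d Hd; destruct (K1 d Hd) as [z [Hz [Hzy K']]].
      exists z; split; [|split]; auto. apply Hlow; auto.
      apply (is_ord_elem_trans a z y x); auto.
    + intros z Hz Hzy; destruct (K2 z Hz Hzy) as [d [Hd K']].
      exists d; split; auto. apply Hlow; auto. apply (is_ord_elem_trans a z y x); auto.
  - split.
    + intros d Hd; apply Hb in Hd; destruct Hd as [z [Hz K]]; apply HBx in Hz.
      destruct Hz; exists z; split; [|split]; auto; apply Hlow; auto.
    + intros z Hz Hzx; destruct (IH z Hz Hzx) as [d K]. exists d; apply Hlow; auto.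
Qed.

End Collapse.

(* Send [(b, i)] to the [b]-th element of [{v ∈ a : C i v}]. *)
Lemma psurj_of_ord_cover (C : M -> M -> Prop) (a I s p : M) :
  dfn2 C -> is_ord a ->
  (forall v, v ∈ a -> exists i, i ∈ I /\ C i v) ->
  (forall i B b v, i ∈ I -> (forall u, u ∈ B <-> (u ∈ a /\ C i u)) ->
     collapse B b v -> b ∈ s) ->
  is_prod p s I -> psurj p a.
Proof.
  intros HC Ha Hcov Hs Hp.
  apply (psurj_exists (fun c v => exists b i B, is_opair c b i /\
    (forall u, u ∈ B <-> (u ∈ a /\ C i u)) /\ collapse B b v)).
  - unfold collapse; dfn_tac.
  - intros c v v' _ _ _ [b [i [B [Hc [HB H]]]]] [b' [i' [B' [Hc' [HB' H']]]]].
    destruct (is_opair_inj _ _ _ _ _ Hc Hc') as [<- <-].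
    assert (B = B') as <-
      (* The index [i] determines the set [B], and then injectivity of the collapse determines
         [v]. *)
      by (apply (zf_extensionality M HZF); intro u; rewrite HB, HB'; tauto).
    apply (collapse_inj a B Ha) with b; auto. intros u Hu; apply HB; auto.
  - intros v Hv. destruct (Hcov v Hv) as [i [Hi HCv]].
    destruct (separation (fun u => C i u) a) as [B HB]; [dfn_tac|].
    destruct (collapse_exists a B Ha) with v as [b Hb];
      [intros u Hu; apply HB; auto | apply HB; auto |].
    destruct (opair_exists b i) as [c Hc]. exists c; split.
    + apply Hp; exists b, i; split; [|split]; auto. apply (Hs i B b v); auto.
    + exists b, i, B; auto.
Qed.

End Sets.

(** * The two inequalities for a covered set *)

Theorem theorem3 (M : structure) (HZF : ZF M)
    (L : (M -> Prop) -> Prop) (HL : cardinal_class L)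
    (Hbounded : ord_bounded L aleph_star)
    (m n : M -> Prop) (Hm : is_cardinal m) (Hn : is_cardinal n)
    (Hcov : Cov L m n) :
  ord_le (aleph n) (aleph_star (card_mul (card (ord_sup L aleph)) m)) /\
  ord_le (aleph_star n)
    (aleph_star (card_mul (card (ord_sup L aleph_star)) m)).
Proof.
  destruct HL as [HLc HLd]; apply dfn1_definable in HLd.
  destruct Hbounded as [b [Hb Hbs]].
  destruct Hcov as [X [I [A [<- [<- [HA [HAL HAX]]]]]]].
  assert (HAI : forall i Ai, maps A i Ai -> i ∈ I).
  { intros i Ai [c [Hc HcA]]. destruct (proj1 HA c HcA) as [i' [y [Hi Hc']]].
    destruct (is_opair_inj HZF _ _ _ _ _ Hc Hc') as [-> _]; auto. }
  assert (HAf : forall i Ai Ai', maps A i Ai -> maps A i Ai' -> Ai = Ai').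
  { intros i Ai Ai' H H'. destruct (proj2 HA i (HAI i Ai H)) as [y [_ Hy]].
    rewrite <- (Hy Ai H); auto. }
  assert (Hsub : forall l, L l -> subset (aleph_star l) b).
  { intros l Hl c Hc; apply (ord_le_mem (aleph_star l)); auto. }
  (* Naming this predicate on sets lets [dfn_tac] treat it as opaque, since [L] itself is applied to
     a cardinal and not to a set. *)
  pose (K := fun x : M => L (card x)). change (dfn1 K) in HLd.
  assert (Hsup : is_sup (fun c => exists l, L l /\ c = aleph l) (ord_sup L aleph)).
  { apply (ord_sup_spec HZF) with b; auto.
    - apply (aleph_ord HZF).
    (* The term [aleph (card x)] is chosen by epsilon; definability is proved for the equivalent
       condition on injections. *)
    - replace (fun a => exists x, L (card x) /\ a ∈ aleph (card x))
        with (fun a => exists x, K x /\ is_ord a /\ exists f, is_inj f a x); [dfn_tac|].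
      apply functional_extensionality; intro a; apply propositional_extensionality.
      split; intros [x H]; exists x; rewrite (mem_aleph HZF) in *; auto.
    - intros l Hl c Hc. apply (Hsub l Hl). destruct (HLc l Hl) as [x ->].
      apply (aleph_le_aleph_star HZF); auto. }
  assert (Hsups : is_sup (fun c => exists l, L l /\ c = aleph_star l) (ord_sup L aleph_star)).
  { apply (ord_sup_spec HZF) with b; auto.
    - apply (aleph_star_ord HZF).
    - replace (fun a => exists x, L (card x) /\ a ∈ aleph_star (card x))
        with (fun a => exists x, K x /\ is_ord a /\ psurj x a); [unfold psurj; dfn_tac|].
      apply functional_extensionality; intro a; apply propositional_extensionality.
      split; intros [x H]; exists x; rewrite (mem_aleph_star HZF) in *; auto. }
  split.
  - set (s := ord_sup L aleph) in *. destruct Hsup as [Hso [Hsle _]].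
    destruct (prod_exists HZF s I) as [p Hp].
    rewrite (card_mul_card HZF _ _ _ Hp).
    apply (ord_le_subset HZF); [apply (aleph_ord HZF) | apply (aleph_star_ord HZF) |].
    intros a Ha; apply (mem_aleph HZF) in Ha; destruct Ha as [Ha [f [Hf Hfi]]].
    apply (mem_aleph_star HZF); split; auto.
    apply (psurj_of_ord_cover HZF
      (* The piece of [a] with index [i] is the preimage of [A_i] under the injection [f]. *)
      (fun i v => exists x Ai, maps f v x /\ maps A i Ai /\ x ∈ Ai) a I s); auto.
    + dfn_tac.
    + intros v Hv. destruct (is_fun_total _ _ _ _ Hf Hv) as [x [Hx H]].
      destruct (HAX x Hx) as [i [Ai [Hi HxA]]]. exists i; split; eauto 6.
    + intros i B c v Hi HB Hc.
      assert (HBa : subset B a) by (intros u Hu; apply HB; auto).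
      destruct (proj2 HA i Hi) as [Ai [HAi _]].
      apply (ord_le_mem (aleph (card Ai))); auto; [apply Hsle; eauto|].
      apply (mem_aleph HZF); split; [apply (collapse_ord HZF a B Ha HBa c v Hc)|].
      (* To show [c] below the Hartogs number of [A_i], send [d ∈ c] to the image under [f] of the
         [d]-th element of [B]. *)
      apply (inj_exists HZF (fun d x => exists u, collapse B d u /\ maps f u x)).
      * unfold collapse; dfn_tac.
      * intros d Hd.
        destruct (proj1 (proj2 (collapse_unfold _ _ _ Hc)) d Hd) as [u [Hu [_ H]]].
        apply HB in Hu; destruct Hu as [_ [x [Ai' [Hux [HAi' Hx]]]]].
        rewrite (HAf _ _ _ HAi HAi'); eauto.
      * intros d x x' _ _ _ [u [H1 H2]] [u' [H1' H2']].
        assert (u = u') as <- by apply (collapse_inj HZF a B Ha HBa _ _ _ H1 H1').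
        apply (is_fun_unique HZF _ _ _ _ _ _ Hf H2 H2').
      * intros d d' x _ _ _ [u [H1 H2]] [u' [H1' H2']].
        assert (u = u') as <- by apply (Hfi _ _ _ H2 H2').
        apply (collapse_fun HZF _ _ _ _ H1 H1').
  - set (s := ord_sup L aleph_star) in *. destruct Hsups as [Hso [Hsle _]].
    destruct (prod_exists HZF s I) as [p Hp].
    rewrite (card_mul_card HZF _ _ _ Hp).
    apply (ord_le_subset HZF); [apply (aleph_star_ord HZF) | apply (aleph_star_ord HZF) |].
    intros a Ha; apply (mem_aleph_star HZF) in Ha; destruct Ha as [Ha [g [Hg Hgs]]].
    apply (mem_aleph_star HZF); split; auto.
    apply (psurj_of_ord_cover HZF
      (* Now the piece with index [i] is the image of [A_i ∩ X] under [g], which is single-valued on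
         [X] only; pieces may overlap. *)
      (fun i v => exists x Ai, x ∈ X /\ maps g x v /\ maps A i Ai /\ x ∈ Ai) a I s); auto.
    + dfn_tac.
    + intros v Hv. destruct (Hgs v Hv) as [x [Hx H]].
      destruct (HAX x Hx) as [i [Ai [Hi HxA]]]. exists i; split; eauto 7.
    + intros i B c v Hi HB Hc.
      assert (HBa : subset B a) by (intros u Hu; apply HB; auto).
      destruct (proj2 HA i Hi) as [Ai [HAi _]].
      apply (ord_le_mem (aleph_star (card Ai))); auto; [apply Hsle; eauto|].
      apply (mem_aleph_star HZF); split; [apply (collapse_ord HZF a B Ha HBa c v Hc)|].
      (* In the opposite direction to the first case, a point [x] of [A_i ∩ X] goes to the position
         in [B] of its value under [g]. *)
      apply (psurj_exists HZF (fun x d => x ∈ X /\ exists u, collapse B d u /\ maps g x u)).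
      * unfold collapse; dfn_tac.
      * intros x d d' _ _ _ [Hx [u [H1 H2]]] [_ [u' [H1' H2']]].
        assert (u = u') as <- by apply (Hg _ _ _ Hx H2 H2').
        apply (collapse_fun HZF _ _ _ _ H1 H1').
      * intros d Hd.
        destruct (proj1 (proj2 (collapse_unfold _ _ _ Hc)) d Hd) as [u [Hu [_ H]]].
        apply HB in Hu; destruct Hu as [_ [x [Ai' [HxX [Hux [HAi' Hx]]]]]].
        rewrite (HAf _ _ _ HAi HAi'); eauto 6.
Qed.
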